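(* Let $d\in\mathbb{N}$, let $\Omega\subset\mathbb{R}^d$ be a bounded domain with smooth boundary $\Gamma$, let $H>0$, and let $w\in\mathcal{W}$ be a reference weight function. Let $\{(\mathcal{X}_N,\mathcal{V}_N,h)\}$ be a family of discrete parameters (particle distribution, particle volume set, influence radius) as defined in the context. Assume that each particle distribution $\mathcal{X}_N$ satisfies $h$-connectivity and that the family is semi-regular. Then there exists a constant $c$ such that, for every element $(\mathcal{X}_N,\mathcal{V}_N,h)$ of the family and every $f\in(V\cap C^1(\overline{\Omega}))^d$, the solution $\mathrm{u}$ of the discrete Poisson equation $$\text{Find } \mathrm{u}\in V_h \text{ such that } -\Delta_h \mathrm{u}_i=\nabla_h^{+}\cdot\widehat{f}_i\quad\text{for all } i\in\Lambda(\Omega),$$ where $\widehat{f}\in V_h^d$ is given by $\widehat{f}_i=f(x_i)$ for $i\in\Lambda(\Omega)$ and $\widehat{f}_i=0$ for $i\in\Lambda(\Gamma_H)$, satisfies $$\|\mathrm{u}\|_{h^1_0(\Omega)}\le c\,\|f\|_{\ell^2(\Omega)}.$$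
   Context: $C(\overline{\Omega})$ is the space of real continuous functions on $\overline{\Omega}$, $C^k(\overline{\Omega})$ is the space of functions in $C(\overline{\Omega})$ with derivatives up to order $k$ (in $C(\overline\Omega)$), and $V=\{v\in C(\overline{\Omega}) : v(x)=0 \text{ for } x\in\Gamma\}$. For fixed $H>0$: $\Omega_H=\{x\in\mathbb{R}^d : \exists y\in\Omega,\ |x-y|<H\}$ and $\Gamma_H=\Omega_H\setminus\Omega$; $|\Omega_H|$ is the volume of $\Omega_H$. For $N\in\mathbb{N}$, a particle distribution is a set $\mathcal{X}_N=\{x_i\in\Omega_H : i=1,\dots,N,\ x_i\ne x_j\ (i\ne j)\}$, and a particle volume set is $\mathcal{V}_N=\{\omega_i>0 : i=1,\dots,N,\ \sum_{i=1}^N\omega_i=|\Omega_H|\}$. The influence radius $h$ is a positive number with $\min\{|x_i-x_j| : i\neq j\}<h<H$. Reference weight functions: $\mathcal{W}$ is the set of $w:[0,\infty)\to\mathbb{R}$ with $w(r)>0$ for $0<r<1$, $w(r)=0$ for $r\ge 1$, and $\int_{\mathbb{R}^d}w(|x|)\,dx=1$. The weight function is $w_h(r)=h^{-d}w(r/h)$. For a function $\phi$ on $\mathcal{X}_N$ write $\phi_i=\phi(x_i)$. For $\psi:\mathcal{X}_N\to\mathbb{R}^d$ and $\phi:\mathcal{X}_N\to\mathbb{R}$, $$\nabla_h^{+}\cdot\psi_i=d\sum_{j\ne i}\omega_j\frac{\psi_j+\psi_i}{|x_j-x_i|}\cdot\frac{x_j-x_i}{|x_j-x_i|}\,w_h(|x_j-x_i|),$$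 $$\Delta_h\phi_i=2d\sum_{j\ne i}\omega_j\frac{\phi_j-\phi_i}{|x_j-x_i|^2}\,w_h(|x_j-x_i|),$$ where sums run over $j\in\{1,\dots,N\}$, $j\neq i$. For $S\subset\mathbb{R}^d$, $\Lambda(S)=\{i\in\{1,\dots,N\} : x_i\in\mathcal{X}_N\cap S\}$. $V_h=\{v:\mathcal{X}_N\to\mathbb{R} : v(x_i)=0 \text{ for } i\in\Lambda(\Gamma_H)\}$. For $S\subset\mathbb{R}^d$, discrete $L^2$ and $H^1_0$ norms: $$\|\psi\|_{\ell^2(S)}=\Big(\sum_{i\in\Lambda(S)}\omega_i|\psi_i|^2\Big)^{1/2},\qquad \|\phi\|_{h^1_0(S)}=\Big(d\sum_{i\in\Lambda(S)}\omega_i\sum_{j\ne i}\omega_j\frac{|\phi_j-\phi_i|^2}{|x_j-x_i|^2}w_h(|x_j-x_i|)\Big)^{1/2},$$ where the inner sum runs over all $j\in\{1,\dots,N\}$, $j\ne i$. For $f$ defined on $\overline{\Omega}$, $\|f\|_{\ell^2(\Omega)}$ uses the values $f_i=f(x_i)$, $i\in\Lambda(\Omega)$. $h$-connectivity: $\mathcal{X}_N$ satisfies $h$-connectivity if for all $i\in\Lambda(\Omega)$ there exist an integer $K\ (\le N)$ and a sequence $\{i_k\}_{k=1}^K\subset\{1,\dots,N\}$ such that $i_1=i$, $|x_{i_k}-x_{i_{k+1}}|<h$ for $1\le k<K$, $i_k\in\Lambda(\Omega)$ for $1\le k<K$, and $i_K\in\Lambda(\Gamma_H)$. Under $h$-connectivity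 the discrete Poisson equation has a unique solution. Semi-regularity: a family $\{(\mathcal{X}_N,\mathcal{V}_N,h)\}$ is semi-regular if there exists a positive constant $c_0$ such that for all elements of the family $$\max_{i=1,\dots,N}\Big\{\sum_{j\ne i}\omega_j w_h(|x_j-x_i|)\Big\}\le c_0.$$ *)

(* Defs.v *)
From HB Require Import structures.
From mathcomp Require Import all_boot all_order all_algebra.
From mathcomp Require Import all_classical all_reals all_analysis.

Set Implicit Arguments.
Unset Strict Implicit.
Unset Printing Implicit Defensive.
Import Order.TTheory GRing.Theory Num.Theory.
Import numFieldNormedType.Exports.
Local Open Scope classical_set_scope.
Local Open Scope ring_scope.

(* Vectors of R^d are row vectors.  The library norm of 'rV[R]_d is the sup
   norm, so the Euclidean norm |x| is introduced separately; the two induce the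
   same topology and the same bounded sets, hence `open`, `closure`,
   `connected`, `continuous` and `bounded_set` keep their usual meaning. *)

Definition dotp (R : realType) (d : nat) (x y : 'rV[R]_d) : R :=
  \sum_(k < d) x 0 k * y 0 k.

Definition enorm (R : realType) (d : nat) (x : 'rV[R]_d) : R :=
  Num.sqrt (dotp x x).

(* Lebesgue measure on R^d: the outer measure obtained from countable covers by
   boxes, followed by Caratheodory's construction.  A box is given by its lower
   and upper corners; `None` is the empty set, so that finite covers (and the
   empty cover, which matters when d = 0) are included. *)

Definition box (R : realType) (d : nat) (q : option ('rV[R]_d * 'rV[R]_d)) :
    set 'rV[R]_d :=
  if q is Some (a, b) then [set x | forall k, a 0 k < x 0 k <= b 0 k] else set0.

Definition proper_box (R : realType) (d : nat)
    (q : option ('rV[R]_d * 'rV[R]_d)) : Prop :=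
  if q is Some (a, b) then forall k, a 0 k <= b 0 k else True.

Definition box_volume (R : realType) (d : nat)
    (q : option ('rV[R]_d * 'rV[R]_d)) : R :=
  if q is Some (a, b) then \prod_(k < d) (b 0 k - a 0 k) else 0.

Definition box_cover (R : realType) (d : nat) (A : set 'rV[R]_d) :
    set (nat -> option ('rV[R]_d * 'rV[R]_d)) :=
  [set q | (forall n, proper_box (q n)) /\ A `<=` \bigcup_n box (q n)].

Definition lebesgue_outer (R : realType) (d : nat) (A : set 'rV[R]_d) :
    \bar R :=
  ereal_inf [set (\sum_(n <oo) (box_volume (q n))%:E)%E | q in box_cover A].

Lemma box_volume_ge0 (R : realType) (d : nat)
    (q : option ('rV[R]_d * 'rV[R]_d)) :
  proper_box q -> (0 <= (box_volume q)%:E)%E.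
Proof.
case: q => [[a b] /= le_ab|//]; rewrite lee_fin.
by apply: prodr_ge0 => k _; rewrite subr_ge0.
Qed.

Lemma lebesgue_outer_ge0 (R : realType) (d : nat) (A : set 'rV[R]_d) :
  (0 <= lebesgue_outer A)%E.
Proof.
apply: le_ereal_inf_tmp => _ [q [q_box _] <-].
by apply: nneseries_ge0 => n _ _; exact: box_volume_ge0.
Qed.

Lemma le_lebesgue_outer (R : realType) (d : nat) :
  {homo @lebesgue_outer R d : A B / A `<=` B >-> (A <= B)%E}.
Proof.
move=> A B AB; apply/ereal_inf_le_tmp => _ [q [q_box Bq] <-].
by exists q => //; split => //; exact: subset_trans AB Bq.
Qed.

Lemma lebesgue_outer0 (R : realType) (d : nat) :
  lebesgue_outer (set0 : set 'rV[R]_d) = 0%E.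
Proof.
apply/eqP; rewrite eq_le; apply/andP; split; last exact: lebesgue_outer_ge0.
apply: ereal_inf_lbound; exists (fun=> None); first by split.
by rewrite eseries0.
Qed.

Lemma lebesgue_outer_sigma_subadditive (R : realType) (d : nat) :
  sigma_subadditive (@lebesgue_outer R d).
Proof.
move=> A; have [[i ioo]|] := pselect (exists i, lebesgue_outer (A i) = +oo%E).
  rewrite (eseries_pinfty _ _ ioo) ?leey// => n _.
  by rewrite -ltNye (lt_le_trans _ (lebesgue_outer_ge0 _)).
rewrite -forallNE => Aoo.
apply/lee_addgt0Pr => e e0.
rewrite (le_trans _ (epsilon_trick _ _ (ltW e0)))//; last first.
  by move=> n; exact: lebesgue_outer_ge0.
pose P n (q : nat -> option ('rV[R]_d * 'rV[R]_d)) := box_cover (A n) q /\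
  (\sum_(k <oo) (box_volume (q k))%:E <=
   lebesgue_outer (A n) + (e / (2 ^ n.+1)%:R)%:E)%E.
have [G PG] : {G : nat -> nat -> option ('rV[R]_d * 'rV[R]_d) &
    forall n, P n (G n)}.
  apply: (@choice _ _ P) => n; rewrite /P.
  have en1 : 0 < e / (2 ^ n.+1)%:R by rewrite divr_gt0// ltr0n expn_gt0.
  have fin : lebesgue_outer (A n) \is a fin_num.
    by rewrite ge0_fin_numE ?lebesgue_outer_ge0// ltey; apply/eqP/Aoo.
  have [_ [q qA <-] /ltW] := lb_ereal_inf_adherent en1 fin.
  by exists q.
have vol_ge0 i j : (0 <= (box_volume (G i j))%:E)%E.
  by apply: box_volume_ge0; case: (PG i) => -[].
pose v (ij : nat * nat) : \bar R := (box_volume (G ij.1 ij.2))%:E.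
have v_ge0 ij : (0 <= v ij)%E by exact: vol_ge0.
apply: (@le_trans _ _ (\esum_(i in setT) v i)%E).
  apply: ereal_inf_lbound => /=.
  have /card_esym/ppcard_eqP[f] := card_nat2.
  exists (fun n => G (f n).1 (f n).2).
    split => [i|x [i _ /(PG i).1.2 [j _ Gij]]]; first exact: (PG _).1.1.
    by exists (f^-1%FUN (i, j)) => //=; rewrite invK ?inE.
  rewrite nneseries_esumT; last by move=> n; exact: vol_ge0.
  by rewrite (reindex_esum setT setT f).
rewrite (_ : esum _ _ = \sum_(i <oo) \sum_(j <oo) v (i, j))%E; last first.
  rewrite nneseries_esumT; last by move=> n; exact: nneseries_ge0.
  rewrite (eq_esum (b := fun i => \esum_(j in setT) v (i, j))%E); last first.
    by move=> i0 _; rewrite nneseries_esumT.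
  rewrite esum_esum //; congr esum; apply/seteqP; split=> -[i j] //=.
apply: lee_nneseries => [n _ _|n _]; first exact: nneseries_ge0.
exact: (PG n).2.
Qed.

HB.instance Definition _ (R : realType) (d : nat) :=
  isOuterMeasure.Build R 'rV[R]_d (@lebesgue_outer R d)
    (@lebesgue_outer0 R d) (@lebesgue_outer_ge0 R d)
    (@le_lebesgue_outer R d) (@lebesgue_outer_sigma_subadditive R d).

Definition lebesgue_outer_measure (R : realType) (d : nat) :
    {outer_measure set 'rV[R]_d -> \bar R} := @lebesgue_outer R d.

Definition lebesgue (R : realType) (d : nat) :
    {measure set (caratheodory_type (lebesgue_outer_measure R d)) -> \bar R} :=
  lebesgue_outer_measure R d.

Definition frontier (T : topologicalType) (A : set T) : set T :=
  closure A `\` interior A.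

Definition is_domain (R : realType) (d : nat) (Omega : set 'rV[R]_d) : Prop :=
  [/\ Omega !=set0, open Omega & connected Omega].

(* C^k up to the boundary: phi is continuous on closure Omega and its partial
   derivatives, defined on the open set Omega, extend to functions that are
   C^(k-1) up to the boundary.  For Omega = setT this is C^k(R^m). *)
Fixpoint Ck_closure (R : realType) (m : nat) (Omega : set 'rV[R]_m) (k : nat)
    (phi : 'rV[R]_m -> R) : Prop :=
  {within closure Omega, continuous phi} /\
  if k is k'.+1 then
    forall i : 'I_m, exists g : 'rV[R]_m -> R,
      (forall x, Omega x -> derivable phi x (delta_mx 0 i) /\
                            'D_(delta_mx 0 i) phi x = g x) /\
      Ck_closure Omega k' g
  else True.

(* Near each boundary point, Omega is one side of the graph of a C^infty
   function of the other d - 1 coordinates; `col' k x` is x with its k-th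
   coordinate removed, and s selects the side. *)
Definition smooth_boundary (R : realType) (d : nat) (Omega : set 'rV[R]_d) :
    Prop :=
  forall p, frontier Omega p ->
    exists (k : 'I_d) (s : bool) (gamma : 'rV[R]_(d.-1) -> R) (r : R),
      [/\ 0 < r, forall n, Ck_closure setT n gamma &
          forall x, enorm (x - p) < r ->
            (Omega x <-> (-1) ^+ s * gamma (col' k x) < (-1) ^+ s * x 0 k)].

Definition V_space (R : realType) (d : nat) (Omega : set 'rV[R]_d) :
    set ('rV[R]_d -> R) :=
  [set v | {within closure Omega, continuous v} /\
           forall x, frontier Omega x -> v x = 0].

Definition Omega_H (R : realType) (d : nat) (Omega : set 'rV[R]_d) (H : R) :
    set 'rV[R]_d :=
  [set x | exists2 y, Omega y & enorm (x - y) < H].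

Definition Gamma_H (R : realType) (d : nat) (Omega : set 'rV[R]_d) (H : R) :
    set 'rV[R]_d :=
  Omega_H Omega H `\` Omega.

(* Functions on [0, +oo[ are total functions on R of which only the values at
   nonnegative arguments are used.  Integrability is part of the meaning of the
   last condition: `\int` is total and would otherwise return a junk value. *)
Definition ref_weight (R : realType) (d : nat) (w : R -> R) : Prop :=
  [/\ forall r, 0 < r < 1 -> 0 < w r,
      forall r, 1 <= r -> w r = 0,
      (lebesgue R d).-integrable setT (fun x => (w (enorm x))%:E) &
      (\int[lebesgue R d]_x (w (enorm x))%:E = 1)%E].

Definition weight (R : realType) (d : nat) (w : R -> R) (h r : R) : R :=
  h ^- d * w (r / h).

(* An element (X_N, V_N, h) of the family.  Particles are indexed by 'I_N, so
   a function on X_N is a function of the index.  The minimum over pairs of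
   distinct particles is taken in \bar R, with value +oo if there is no pair. *)
Record discr_param (R : realType) (d : nat) (Omega : set 'rV[R]_d) (H : R) :=
  DiscrParam {
    npart : nat;
    pos : 'I_npart -> 'rV[R]_d;
    vol : 'I_npart -> R;
    infl : R;
    pos_inj : injective pos;
    pos_Omega_H : forall i, Omega_H Omega H (pos i);
    vol_gt0 : forall i, 0 < vol i;
    vol_sum : (\sum_i vol i)%:E = lebesgue R d (Omega_H Omega H);
    infl_gt0 : 0 < infl;
    infl_gt_min :
      (\big[Order.min/+oo]_(ij : 'I_npart * 'I_npart | ij.1 != ij.2)
         (enorm (pos ij.1 - pos ij.2))%:E < infl%:E)%E;
    infl_lt_H : infl < H
  }.
Arguments pos {R d Omega H} p i : rename.
Arguments vol {R d Omega H} p i : rename.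

Definition Lambda (R : realType) (d : nat) (Omega : set 'rV[R]_d) (H : R)
    (p : discr_param Omega H) (S : set 'rV[R]_d) : pred 'I_(npart p) :=
  [pred i | pos p i \in S].
Arguments Lambda {R d Omega H} p S.

Definition dist (R : realType) (d : nat) (Omega : set 'rV[R]_d) (H : R)
    (p : discr_param Omega H) (i j : 'I_(npart p)) : R :=
  enorm (pos p j - pos p i).

Definition wh (R : realType) (d : nat) (Omega : set 'rV[R]_d) (H : R)
    (w : R -> R) (p : discr_param Omega H) (i j : 'I_(npart p)) : R :=
  weight d w (infl p) (dist i j).

Definition discrete_div (R : realType) (d : nat) (Omega : set 'rV[R]_d)
    (H : R) (w : R -> R) (p : discr_param Omega H)
    (psi : 'I_(npart p) -> 'rV[R]_d) (i : 'I_(npart p)) : R :=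
  d%:R * \sum_(j | j != i)
    vol p j * dotp ((dist i j)^-1 *: (psi j + psi i))
                   ((dist i j)^-1 *: (pos p j - pos p i)) * wh w i j.

Definition discrete_laplacian (R : realType) (d : nat) (Omega : set 'rV[R]_d)
    (H : R) (w : R -> R) (p : discr_param Omega H)
    (phi : 'I_(npart p) -> R) (i : 'I_(npart p)) : R :=
  2%:R * d%:R * \sum_(j | j != i)
    vol p j * ((phi j - phi i) / dist i j ^+ 2) * wh w i j.

Definition l2_norm (R : realType) (d : nat) (Omega : set 'rV[R]_d) (H : R)
    (p : discr_param Omega H) (S : set 'rV[R]_d) (m : nat)
    (psi : 'I_(npart p) -> 'rV[R]_m) : R :=
  Num.sqrt (\sum_(i in Lambda p S) vol p i * enorm (psi i) ^+ 2).

Definition h10_norm (R : realType) (d : nat) (Omega : set 'rV[R]_d) (H : R)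
    (w : R -> R) (p : discr_param Omega H) (S : set 'rV[R]_d)
    (phi : 'I_(npart p) -> R) : R :=
  Num.sqrt (d%:R * \sum_(i in Lambda p S) vol p i *
    \sum_(j | j != i)
      vol p j * (`|phi j - phi i| ^+ 2 / dist i j ^+ 2) * wh w i j).

Definition V_h (R : realType) (d : nat) (Omega : set 'rV[R]_d) (H : R)
    (p : discr_param Omega H) : set ('I_(npart p) -> R) :=
  [set v | forall i, i \in Lambda p (Gamma_H Omega H) -> v i = 0].

(* The sequence i_1, ..., i_K is s 1, ..., s K. *)
Definition h_connected (R : realType) (d : nat) (Omega : set 'rV[R]_d) (H : R)
    (p : discr_param Omega H) : Prop :=
  forall i, i \in Lambda p Omega ->
    exists (K : nat) (s : nat -> 'I_(npart p)),
      [/\ (0 < K <= npart p)%N, s 1%N = i,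
          forall k, (1 <= k < K)%N -> dist (s k) (s k.+1) < infl p,
          forall k, (1 <= k < K)%N -> s k \in Lambda p Omega &
          s K \in Lambda p (Gamma_H Omega H)].

Definition semi_regular (R : realType) (d : nat) (Omega : set 'rV[R]_d)
    (H : R) (w : R -> R) (F : set (discr_param Omega H)) : Prop :=
  exists2 c0 : R, 0 < c0 &
    forall p, F p ->
      \big[Num.max/0]_(i < npart p) (\sum_(j | j != i) vol p j * wh w i j)
        <= c0.

Definition f_hat (R : realType) (d : nat) (Omega : set 'rV[R]_d) (H : R)
    (p : discr_param Omega H) (f : 'rV[R]_d -> 'rV[R]_d) (i : 'I_(npart p)) :
    'rV[R]_d :=
  if i \in Lambda p Omega then f (pos p i) else 0.

Definition discrete_poisson (R : realType) (d : nat) (Omega : set 'rV[R]_d)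
    (H : R) (w : R -> R) (p : discr_param Omega H) (f : 'rV[R]_d -> 'rV[R]_d)
    (u : 'I_(npart p) -> R) : Prop :=
  V_h u /\ forall i, i \in Lambda p Omega ->
    - discrete_laplacian w u i = discrete_div w (f_hat f) i.

(* Main.v *)
Require Import Defs.
From mathcomp Require Import all_boot all_order all_algebra.
From mathcomp Require Import all_classical all_reals all_analysis.
From mathcomp Require Import ring lra.
Import Order.TTheory GRing.Theory Num.Theory.
Import numFieldNormedType.Exports.
Local Open Scope classical_set_scope.
Local Open Scope ring_scope.

(** Test the equation with [vol i * u i] and sum over all particles, which is
    allowed because [u] vanishes on [Gamma_H].  Write [r] and [n] for the
    distance and the unit vector from particle [i] to particle [j], and
    [A = d * vol i * vol j * wh i j >= 0].  Since the Laplacian has a symmetric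
    kernel and the divergence an antisymmetric one, symmetrizing the double sums
    gives
      [2 sum A ((u_j - u_i)/r)^2 = sum A ((u_i - u_j)/r) (f_i + f_j).n].
    Expanding [|((u_i - u_j)/r) n - (f_i + f_j)/2|^2 >= 0] bounds the right side
    by [sum A (((u_j - u_i)/r)^2 + (|f_i|^2 + |f_j|^2)/2)], and semi-regularity
    bounds [sum A |f_i|^2] by [d c0 |f|^2], so that [c = sqrt (d c0)] works. *)

Section Dotp.
Context {R : realType} {d : nat}.
Implicit Types (a : R) (x y z : 'rV[R]_d).

Lemma dotpC x y : dotp x y = dotp y x.
Proof. by apply: eq_bigr => k _; rewrite mulrC. Qed.

Lemma dotpDl x y z : dotp (x + y) z = dotp x z + dotp y z.
Proof. by rewrite -big_split; apply: eq_bigr => k _; rewrite mxE mulrDl. Qed.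

Lemma dotpZl a x y : dotp (a *: x) y = a * dotp x y.
Proof. by rewrite mulr_sumr; apply: eq_bigr => k _; rewrite mxE mulrA. Qed.

Lemma dotpDr x y z : dotp x (y + z) = dotp x y + dotp x z.
Proof. by rewrite !(dotpC x) dotpDl. Qed.

Lemma dotpZr a x y : dotp x (a *: y) = a * dotp x y.
Proof. by rewrite !(dotpC x) dotpZl. Qed.

Lemma dotpxx_ge0 x : 0 <= dotp x x.
Proof. by apply: sumr_ge0 => k _; rewrite -expr2 sqr_ge0. Qed.

Lemma dotpxx_eq0 x : (dotp x x == 0) = (x == 0).
Proof.
apply/eqP/eqP => [x0|->]; last by apply: big1 => k _; rewrite mxE mul0r.
apply/rowP => k; rewrite mxE; apply/eqP; rewrite -sqrf_eq0 expr2; apply/eqP.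
by apply: (psumr_eq0P _ x0) => // l _; rewrite -expr2 sqr_ge0.
Qed.

Lemma enorm_sqr x : enorm x ^+ 2 = dotp x x.
Proof. by rewrite sqr_sqrtr // dotpxx_ge0. Qed.

Lemma enorm_gt0 x : x != 0 -> 0 < enorm x.
Proof. by move=> x0; rewrite sqrtr_gt0 lt_def dotpxx_ge0 dotpxx_eq0 x0. Qed.

Lemma enormB x y : enorm (x - y) = enorm (y - x).
Proof.
by congr Num.sqrt; rewrite -opprB -scaleN1r dotpZl dotpZr mulrA mulrNN !mul1r.
Qed.

(** Expanding [|a n - (x + y)/2|^2 >= 0] leaves the term [|x + y|^2 / 4], and [|x - y|^2 >= 0]
    bounds it by [(|x|^2 + |y|^2) / 2]. *)
Lemma dotp_unit_le a x y n : dotp n n = 1 ->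
  a * dotp (x + y) n <= a ^+ 2 + (dotp x x + dotp y y) / 2.
Proof.
move=> n1.
have := dotpxx_ge0 (a *: n + (- 2^-1) *: (x + y)).
have := dotpxx_ge0 (x + (- 1) *: y).
rewrite !(dotpDl, dotpDr, dotpZl, dotpZr) n1 (dotpC n) (dotpC n) (dotpC y x).
by lra.
Qed.

End Dotp.

(** Twice an off-diagonal sum equals the sum of its terms paired under the swap of indices, so
    comparing pairs suffices even where single terms do not compare. *)
Lemma le_offdiag_sum {R : realDomainType} {I : finType} {g k : I -> I -> R} :
  (forall i j, i != j -> g i j + g j i <= k i j + k j i) ->
  \sum_i \sum_(j | j != i) g i j <= \sum_i \sum_(j | j != i) k i j.
Proof.
move=> gk; rewrite -(ler_pMn2r (ltn0Sn 1)).
have sym (e : I -> I -> R) : (\sum_i \sum_(j | j != i) e i j) *+ 2 =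
    \sum_i \sum_(j | j != i) (e i j + e j i).
  rewrite mulr2n [X in _ + X](exchange_big_dep predT) //= -big_split.
  apply: eq_bigr => i _; rewrite big_split /=; congr (_ + _).
  by apply: eq_bigl => j; rewrite eq_sym.
rewrite !sym; apply: ler_sum => i _; apply: ler_sum => j ji.
by apply: gk; rewrite eq_sym.
Qed.

Section Particles.
Context {R : realType} {d : nat} {Omega : set 'rV[R]_d} {H : R} {w : R -> R}.
Variable p : discr_param Omega H.
Implicit Types (i j : 'I_(npart p)) (S : set 'rV[R]_d).

Lemma distC i j : dist i j = dist j i.
Proof. exact: enormB. Qed.

Lemma whC i j : wh w i j = wh w j i.
Proof. by rewrite /wh distC. Qed.

Lemma dist_gt0 i j : i != j -> 0 < dist i j.
Proof.
move=> ij.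
by rewrite enorm_gt0 // subr_eq0 (inj_eq (@pos_inj _ _ _ _ p)) eq_sym.
Qed.

(** The sign of [w 0] is left free by [ref_weight]; [i != j] makes the distance positive. *)
Lemma wh_ge0 i j : ref_weight d w -> i != j -> 0 <= wh w i j.
Proof.
move=> [w_gt0 w_eq0 _ _] ij; have h0 := infl_gt0 p.
apply: mulr_ge0; first by rewrite invr_ge0 exprn_ge0 // ltW.
have [/w_eq0 -> //|r1] := leP 1 (dist i j / infl p).
by rewrite ltW // w_gt0 // r1 andbT divr_gt0 // dist_gt0.
Qed.

Lemma vol_ge0 i : 0 <= vol p i.
Proof. exact/ltW/vol_gt0. Qed.

Lemma edge_weight_ge0 i j :
  ref_weight d w -> i != j -> 0 <= vol p i * vol p j * wh w i j.
Proof.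
move=> w_ref ij.
by apply: mulr_ge0; [rewrite mulr_ge0 ?vol_ge0 | exact: wh_ge0].
Qed.

Lemma Lambda_Gamma_H i :
  i \notin Lambda p Omega -> i \in Lambda p (Gamma_H Omega H).
Proof.
move=> /negP iO; apply/mem_set; split; first exact: pos_Omega_H.
by move=> Oi; apply: iO; apply/mem_set.
Qed.

Lemma discrete_energy_identity (f : 'rV[R]_d -> 'rV[R]_d)
    (u : 'I_(npart p) -> R) : discrete_poisson w f u ->
  \sum_i \sum_(j | j != i) vol p i * vol p j * wh w i j *
    (2 * d%:R * (u i * (u i - u j)) / dist i j ^+ 2 -
     d%:R * u i * dotp ((dist i j)^-1 *: (f_hat f j + f_hat f i))
                       ((dist i j)^-1 *: (pos p j - pos p i))) = 0.
Proof.
move=> [uV eq_u].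
(* Multiplied by [u i], the equation extends from [Lambda p Omega] to every particle. *)
have {}eq_u i :
    vol p i * u i * (- discrete_laplacian w u i - discrete_div w (f_hat f) i) = 0.
  have [/eq_u ->|/Lambda_Gamma_H /uV ->] := boolP (i \in Lambda p Omega).
    by rewrite subrr mulr0.
  by rewrite mulr0 mul0r.
apply: big1 => i _; rewrite -[RHS](eq_u i).
rewrite /discrete_laplacian /discrete_div -mulrN -sumrN !mulr_sumr -sumrB.
by rewrite mulr_sumr; apply: eq_bigr => j _; ring.
Qed.

Lemma discrete_energy_le (f : 'rV[R]_d -> 'rV[R]_d) (u : 'I_(npart p) -> R) :
  ref_weight d w -> discrete_poisson w f u ->
  \sum_i \sum_(j | j != i)
     d%:R * (vol p i * vol p j * wh w i j) * ((u j - u i) / dist i j) ^+ 2 <=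
  \sum_i \sum_(j | j != i)
     d%:R * (vol p i * vol p j * wh w i j) * dotp (f_hat f i) (f_hat f i).
Proof.
move=> w_ref /discrete_energy_identity eq_u; rewrite -subr_le0.
(* Zero is replaced by twice the energy identity: with this factor, the claim for each symmetrized
   pair is a multiple of [dotp_unit_le]. *)
rewrite -[leRHS](mulr0 2) -[X in _ <= 2 * X]eq_u -sumrB mulr_sumr.
under eq_bigr do rewrite -sumrB.
under [leRHS]eq_bigr do rewrite mulr_sumr.
apply: le_offdiag_sum => i j ij.
(* Swapping [i] and [j] only reverses the direction vector; this sign combines the factors [u i] and
   [u j] into [u i - u j]. *)
rewrite (distC j i) (whC j i) (addrC (f_hat f i)) -[pos p i - _]opprB.
set fi := f_hat f i; set fj := f_hat f j; set x := pos p j - pos p i.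
have r0 := dist_gt0 _ _ ij; have r_neq0 := lt0r_neq0 r0.
rewrite (scalerN _ x) -[- (_ *: x)]scaleN1r (dotpZr (-1)).
rewrite !(dotpZl (dist i j)^-1).
set n := (dist i j)^-1 *: x.
have n1 : dotp n n = 1.
  by rewrite dotpZl dotpZr -enorm_sqr -/(dist i j); field.
have := dotp_unit_le ((u i - u j) / dist i j) fj fi n n1.
have : 0 <= d%:R * (vol p i * vol p j * wh w i j).
  by rewrite mulr_ge0 ?edge_weight_ge0.
set A := d%:R * _ => A0 /(ler_wpM2l A0).
set D := dotp (fj + fi) n; set Ni := dotp fi fi; set Nj := dotp fj fj => le_D.
(* The gap between the two sides is exactly twice the gap in [le_D]. *)
rewrite -subr_ge0; move: le_D; rewrite -subr_ge0 -(pmulr_rge0 _ (ltr0n R 2)).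
by congr (0 <= _); rewrite /A; field.
Qed.

Lemma h10_norm_le (c0 : R) (f : 'rV[R]_d -> 'rV[R]_d) (u : 'I_(npart p) -> R) :
  ref_weight d w -> 0 <= c0 ->
  (forall i, \sum_(j | j != i) vol p j * wh w i j <= c0) ->
  discrete_poisson w f u ->
  h10_norm w Omega u <=
    Num.sqrt (d%:R * c0) * l2_norm Omega (fun i => f (pos p i)).
Proof.
move=> w_ref c00 le_c0 eq_u.
rewrite -sqrtrM ?mulr_ge0 //; apply: ler_wsqrtr.
have := discrete_energy_le _ _ w_ref eq_u.
set E := (X in X <= _ -> _) => E_le; apply: (@le_trans _ _ E).
  (* Compared with the squared norm, [E] has extra nonnegative terms, those with [i] outside
     [Lambda p Omega]. *)
  rewrite mulr_sumr [leLHS]big_mkcond /= /E; apply: ler_sum => i _.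
  case: ifP => _; last first.
    apply: sumr_ge0 => j ji; rewrite mulr_ge0 ?sqr_ge0 //.
    by rewrite mulr_ge0 ?edge_weight_ge0 // eq_sym.
  rewrite !mulr_sumr; apply: ler_sum => j _.
  rewrite real_normK ?num_real // -expr_div_n.
  by rewrite [leLHS](_ : _ = d%:R * (vol p i * vol p j * wh w i j) *
    ((u j - u i) / dist i j) ^+ 2) //; ring.
apply: le_trans E_le _.
(* Outside [Omega] both sides vanish, since [f_hat] does; inside, [|f_i|^2] leaves the inner sum,
   and what remains is bounded by [c0]. *)
rewrite mulr_sumr [leRHS]big_mkcond /=; apply: ler_sum => i _.
rewrite /f_hat; case: ifP => _; last first.
  by rewrite big1 // => j _; rewrite -(scale0r 0) dotpZl mul0r mulr0.
set N := dotp _ _.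
rewrite enorm_sqr -/N [leRHS](_ : _ = d%:R * (vol p i * N) * c0); last by ring.
rewrite [leLHS](_ : _ =
    d%:R * (vol p i * N) * \sum_(j | j != i) vol p j * wh w i j); last first.
  by rewrite mulr_sumr; apply: eq_bigr => j _; ring.
by rewrite ler_wpM2l // !mulr_ge0 ?vol_ge0 ?dotpxx_ge0.
Qed.

End Particles.

Theorem theorem9 (R : realType) (d : nat) (Omega : set 'rV[R]_d) (H : R)
    (w : R -> R) (F : set (discr_param Omega H)) :
  (0 < d)%N ->
  is_domain Omega -> bounded_set Omega -> smooth_boundary Omega ->
  0 < H ->
  ref_weight d w ->
  (forall p, F p -> h_connected p) ->
  semi_regular w F ->
  exists c : R, forall p, F p ->
    forall f : 'rV[R]_d -> 'rV[R]_d,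
      (forall k : 'I_d, V_space Omega (fun x => f x 0 k) /\
                        Ck_closure Omega 1 (fun x => f x 0 k)) ->
      forall u : 'I_(npart p) -> R, discrete_poisson w f u ->
        h10_norm w Omega u <= c * l2_norm Omega (fun i => f (pos p i)).
Proof.
move=> _ _ _ _ _ w_ref _ [c0 c0_gt0 le_c0].
(* The constant depends only on [d] and [c0], hence is uniform over the family and over [f]. *)
exists (Num.sqrt (d%:R * c0)) => p /le_c0 {}le_c0 f _ u.
apply: h10_norm_le => // [|i]; first exact: ltW.
exact: le_trans (le_bigmax _ _ i) le_c0.
Qed.
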